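(* There is a monotonically shrinking temporal path $\mathcal{P}$ and a monotonically shrinking temporal cycle $\mathcal{C}$, both consisting of two layers, such that there is no Nash equilibrium in the two-player temporal Voronoi game $\mathrm{Vor}(\mathcal{P},2)$ and no Nash equilibrium in the two-player temporal Voronoi game $\mathrm{Vor}(\mathcal{C},2)$.
   Context: A temporal graph $\mathcal{G}=(V,(E_t)_{t=1}^\infty)$ consists of a finite vertex set $V$ and edge sets $E_t\subseteq\binom{V}{2}$. When only $E_1,\dots,E_\tau$ are specified (''$\tau$ layers''), $E_t=E_\tau$ for all $t>\tau$. The underlying graph is $(V,\bigcup_t E_t)$. A temporal path (cycle) is a temporal graph whose underlying graph is a path (cycle). $\mathcal{G}$ is monotonically shrinking if $E_{t+1}\subseteq E_t$ for all $t$. A temporal walk from $v_0$ to $v_d$ is a sequence $(\{v_0,v_1\},t_1),\dots,(\{v_{d-1},v_d\},t_d)$ with $t_1<t_2<\dots<t_d$ and $\{v_{i-1},v_i\}\in E_{t_i}$ for all $i$; its arrival time is $t_d$. $\mathrm{td}(u,v)$ is the smallest arrival time of a temporal walk from $u$ to $v$ ($\infty$ if none exists, and $\mathrm{td}(v,v)=0$). Two-player temporal Voronoi game $\mathrm{Vor}(\mathcal{G},2)$: players $1,2$ choose vertices $p_1,p_2\in V$ simultaneously. The payoff of player $i$ is the number of vertices $v$ with $\mathrm{td}(p_i,v)<\mathrm{td}(p_j,v)$, where $j\ne i$ is the other player. A profile $(p_1,p_2)$ is a Nash equilibrium if no player can strictly increase her payoff by unilaterally choosing another vertex. *)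

(* Defs.v *)
From mathcomp Require Import all_boot.
From mathcomp Require Import boolp.

Set Implicit Arguments.
Unset Strict Implicit.
Unset Printing Implicit Defensive.

(* Time steps are 1, 2, 3, ...: layer t is the edge set E_t for t >= 1, and    *)
(* layer 0 is a dummy value, ignored by every definition below.                *)
Record temporal_graph (V : finType) := TemporalGraph {
  layer :> nat -> {set {set V}};
  layer_edges : forall t e, e \in layer t -> #|e| = 2
}.

Section TemporalGraph.
Variables (V : finType) (G : temporal_graph V).

Definition consists_of_layers (tau : nat) : Prop :=
  forall t, tau < t -> G t = G tau.

Definition monotonically_shrinking : Prop :=
  forall t, 0 < t -> G t.+1 \subset G t.

Definition underlying_edge (e : {set V}) : Prop :=
  exists2 t, 0 < t & e \in G t.

Definition path_edges (s : seq V) : seq {set V} :=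
  [seq [set p.1; p.2] | p <- zip s (behead s)].

Definition cycle_edges (s : seq V) : seq {set V} :=
  [seq [set p.1; p.2] | p <- zip s (rot 1 s)].

Definition temporal_path : Prop :=
  exists s : seq V,
    [/\ 0 < size s, uniq s, forall v, v \in s
      & forall e, underlying_edge e <-> e \in path_edges s].

Definition temporal_cycle : Prop :=
  exists s : seq V,
    [/\ 2 < size s, uniq s, forall v, v \in s
      & forall e, underlying_edge e <-> e \in cycle_edges s].

Definition temporal_step : rel (V * nat) :=
  fun x y => (x.2 < y.2) && ([set x.1; y.1] \in G y.2).

(* The walk ({v_0,v_1},t_1), ..., ({v_{d-1},v_d},t_d) from v_0 is encoded as   *)
(* w = [:: (v_1, t_1); ...; (v_d, t_d)]. Starting from (v_0, 0) forces         *)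
(* 1 <= t_1, and the empty walk reaches v_0 at time 0, whence td v_0 v_0 = 0.  *)
Definition temporal_walk (u v : V) (t : nat) (w : seq (V * nat)) : Prop :=
  path temporal_step (u, 0) w /\ last (u, 0) w = (v, t).

Definition arrival (u v : V) : pred nat :=
  fun t => `[< exists w, temporal_walk u v t w >].

(* None stands for infinity. *)
Definition td (u v : V) : option nat :=
  if pselect (exists t, arrival u v t) is left ex then Some (ex_minn ex)
  else None.

Definition td_lt (a b : option nat) : bool :=
  match a, b with
  | Some m, Some n => m < n
  | Some _, None => true
  | None, _ => false
  end.

(* The game is symmetric: payoff p q is the payoff of the player at p when the *)
(* other player is at q.                                                       *)
Definition payoff (p q : V) : nat :=
  #|[set v | td_lt (td p v) (td q v)]|.

Definition nash_equilibrium (p1 p2 : V) : Prop :=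
  (forall q, payoff q p2 <= payoff p1 p2) /\
  (forall q, payoff q p1 <= payoff p2 p1).

End TemporalGraph.

(* Main.v *)
(* Let E_1 be the path 0-1-...-6, respectively the cycle 0-1-...-6-0. Deleting
   the edges 01 and 12 from the path, respectively 01 and 23 from the cycle,
   gives an E_2 for which the game has no Nash equilibrium. The sets of vertices
   reached up to time t become stationary, so that all temporal distances, all
   payoffs and the absence of an equilibrium are found by computation. *)
Require Import Defs.
From mathcomp Require Import all_boot.
From mathcomp Require Import boolp.

Set Implicit Arguments.
Unset Strict Implicit.
Unset Printing Implicit Defensive.

Section TwoLayers.
Variables (V : finType) (e1 e2 : seq (V * V)).

Definition edge_set (es : seq (V * V)) : {set {set V}} :=
  [set e in [seq [set p.1; p.2] | p <- es]].

(** A test on lists of pairs that evaluates, in contrast to membership in a set of sets. *)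
Definition adj (es : seq (V * V)) : rel V :=
  fun x y => ((x, y) \in es) || ((y, x) \in es).

Lemma edge_set_adj es x y : ([set x; y] \in edge_set es) = adj es x y.
Proof.
rewrite inE; apply/mapP/orP => [[[a b] ab_es /= xyE]|].
  (* Inclusion in both directions makes the pairs equal up to order, even if $x=y$. *)
  have /set2P xab : x \in [set a; b] by rewrite -xyE set21.
  have /set2P yab : y \in [set a; b] by rewrite -xyE set22.
  have /set2P aE : a \in [set x; y] by rewrite xyE set21.
  have /set2P bE : b \in [set x; y] by rewrite xyE set22.
  by case: xab yab aE bE => ? [] ? [] ? [] ?; subst; auto.
by case=> xyE; [exists (x, y) | exists (y, x); rewrite //= setUC].
Qed.

(** The dummy layer 0 gets the edges of $E_1$. *)
Definition layer_pairs (t : nat) := if t <= 1 then e1 else e2.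

Hypothesis loopless : all (fun p => p.1 != p.2) (e1 ++ e2).

Lemma edge_set_card t e : e \in edge_set (layer_pairs t) -> #|e| = 2.
Proof.
rewrite inE => /mapP[p p_t ->]; rewrite cards2.
suff /(allP loopless) -> : p \in e1 ++ e2 by [].
by rewrite mem_cat; move: p_t; rewrite /layer_pairs; case: ifP => _ ->; rewrite ?orbT.
Qed.

Definition two_layer_graph : temporal_graph V := TemporalGraph edge_set_card.

Lemma two_layer_graph_layers : consists_of_layers two_layer_graph 2.
Proof. by case=> [|[|t]]. Qed.

Hypothesis sub_e : {subset e2 <= e1}.

Lemma two_layer_graph_shrinking : monotonically_shrinking two_layer_graph.
Proof.
case=> [|[|t]] // _; apply/subsetP => e; rewrite !inE.
by case/mapP => p /sub_e p1 ->; apply: map_f.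
Qed.

Lemma two_layer_graph_underlying e :
  underlying_edge two_layer_graph e <-> e \in [seq [set p.1; p.2] | p <- e1].
Proof.
split=> [[[|[|t]] // _]|ee1]; rewrite ?inE //; last by exists 1; rewrite ?inE.
by case/mapP => p /sub_e p1 ->; apply: map_f.
Qed.

Variable s : seq V.
Hypotheses (uniq_s : uniq s) (mem_s : forall v, v \in s).

(** The vertices reached from [u] by time [t]. Filtering [s] fixes their order at positive times, so
    stationarity can be tested by equality of lists. *)
Fixpoint reach (u : V) (t : nat) : seq V :=
  if t is t'.+1 then
    let r := reach u t' in
    [seq v <- s | (v \in r) || has (fun w => adj (layer_pairs t) w v) r]
  else [:: u].

Lemma reach_homo u v t t' : t <= t' -> v \in reach u t -> v \in reach u t'.
Proof.
move/subnK <-; elim: (t' - t) => [//|k IHk] /IHk v_k.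
by rewrite addSn /= mem_filter v_k mem_s.
Qed.

Lemma mem_reachP u v t :
  reflect (exists2 t', t' <= t & arrival two_layer_graph u v t') (v \in reach u t).
Proof.
apply: (iffP idP) => [|[t' le_t't /asboolP[w]]].
  elim: t v => [|t IHt] v /=.
    by rewrite inE => /eqP->; exists 0 => //; apply/asboolP; exists [::].
  rewrite mem_filter mem_s andbT => /orP[/IHt[t' le_t't ?]|].
    by exists t' => //; apply: leqW.
  case/hasP => x /IHt[t' le_t't /asboolP[w [path_w last_w]]] adj_xv.
  exists t.+1 => //; apply/asboolP; exists (rcons w (v, t.+1)).
  split; rewrite ?last_rcons // rcons_path path_w last_w /temporal_step /=.
  by rewrite ltnS le_t't edge_set_adj.
move=> walk_w; apply: (reach_homo le_t't).
elim/last_ind: w v t' walk_w {le_t't} => [|w y IHw] v t'.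
  by case=> _ [<- <-]; rewrite inE.
case; rewrite rcons_path last_rcons => /andP[path_w + ydef]; rewrite {}ydef.
case def_x: (last _ w) => [x k] /andP[/= lt_kt]; rewrite edge_set_adj.
case: t' lt_kt => // t' le_kt' adj_xv; rewrite /= mem_filter mem_s andbT.
apply/orP; right; apply/hasP; exists x => //.
(* Times increase strictly, so the last edge leaves a vertex reached at a time [k] of at most
   [t']. *)
exact: (reach_homo (t := k) le_kt') (IHw _ _ (conj path_w def_x)).
Qed.

Lemma mem_reach_td u v t :
  (v \in reach u t) = if td two_layer_graph u v is Some m then m <= t else false.
Proof.
rewrite /td; case: pselect => [ex|nex].
  case: ex_minnP => m arr_m min_m; apply/mem_reachP/idP; last by exists m.
  by case=> t' le_t't /min_m/leq_trans; apply.
by apply/mem_reachP => -[t' _ arr_t']; apply: nex; exists t'.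
Qed.

Variable N : nat.
Hypothesis stableN : all (fun u => reach u N.+2 == reach u N.+1) s.

(** All steps into times from [N.+2] on use $E_2$, because [N.+2] is at least 2; hence one
    repetition persists. *)
Lemma reach_stable u t : N < t -> reach u t = reach u N.+1.
Proof.
move/subnK <-; elim: (t - N.+1) => [//|k IHk].
rewrite addSn -[RHS](eqP (allP stableN u (mem_s u))) /= IHk.
by rewrite /layer_pairs addnS.
Qed.

Definition earlier (rp rq : seq (seq V)) (v : V) : bool :=
  has (fun r => (v \in r.1) && (v \notin r.2)) (zip rp rq).

Definition reaches (u : V) : seq (seq V) := [seq reach u t | t <- iota 0 N.+2].

(** The arrival time from [p], if earlier, is a time at which [v] is reached from [p] but not from
    [q]; any such time separates the two distances. Stability bounds the search by [N.+1]. *)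
Lemma td_ltE p q v :
  td_lt (td two_layer_graph p v) (td two_layer_graph q v)
    = earlier (reaches p) (reaches q) v.
Proof.
rewrite /earlier /reaches zip_map has_map; apply/idP/hasP => /=.
  case tdp: (td _ p v) => [m|//] lt_pq.
  have vp: v \in reach p m by rewrite mem_reach_td tdp /=.
  have m_le: m <= N.+1.
    (* A vertex first reached after [N.+1] would by stability already belong to [reach p N.+1]. *)
    rewrite leqNgt; apply/negP => lt_Nm; move: vp.
    by rewrite (reach_stable _ (ltnW lt_Nm)) mem_reach_td tdp leqNgt lt_Nm.
  exists m; first by rewrite (mem_iota 0 N.+2).
  by rewrite /= vp mem_reach_td; case: (td _ q v) lt_pq => //= n; rewrite -ltnNge.
case=> t _ /=; rewrite !mem_reach_td.
case: (td _ p v) => // m; case: (td _ q v) => //= n /andP[le_mt].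
by rewrite -ltnNge; apply: leq_ltn_trans.
Qed.

Definition count_earlier (rp rq : seq (seq V)) : nat := count (earlier rp rq) s.

Lemma payoffE p q :
  payoff two_layer_graph p q = count_earlier (reaches p) (reaches q).
Proof.
rewrite /payoff /count_earlier -size_filter.
rewrite -(card_uniqP (filter_uniq _ uniq_s)); apply: eq_card => v.
by rewrite inE mem_filter mem_s andbT td_ltE.
Qed.

(** Quantifying over the tables in [rs] instead of vertices lets each table be computed only
    once. *)
Definition deviation_everywhere : bool :=
  let rs := [seq reaches p | p <- s] in
  all (fun p => all (fun q => has (fun x =>
    (count_earlier p q < count_earlier x q)
    || (count_earlier q p < count_earlier x p)) rs) rs) rs.

Lemma no_nash_equilibrium :
  deviation_everywhere -> ~ exists p q, nash_equilibrium two_layer_graph p q.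
Proof.
move=> dev [p [q [bestp bestq]]].
have mem_rs u : reaches u \in [seq reaches p | p <- s] by rewrite map_f.
have /hasP[_ /mapP[x _ ->]] := allP (allP dev _ (mem_rs p)) _ (mem_rs q).
by rewrite -!payoffE !ltnNge bestp bestq.
Qed.

End TwoLayers.

Definition vertices7 : seq 'I_7 :=
  [:: @Ordinal 7 0 isT; @Ordinal 7 1 isT; @Ordinal 7 2 isT; @Ordinal 7 3 isT;
      @Ordinal 7 4 isT; @Ordinal 7 5 isT; @Ordinal 7 6 isT].

Lemma uniq_vertices7 : uniq vertices7.
Proof. by []. Qed.

Lemma mem_vertices7 v : v \in vertices7.
Proof. by rewrite -(mem_map val_inj) /= (mem_iota 0 7) ltn_ord. Qed.

(** This and [cycle7] copy the form of [path_edges] and [cycle_edges], so that the underlying graphs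
    agree by conversion. *)
Definition path7 := zip vertices7 (behead vertices7).

Definition cycle7 := zip vertices7 (rot 1 vertices7).

Lemma path7_loopless : all (fun p => p.1 != p.2) (path7 ++ drop 2 path7).
Proof. by []. Qed.

Definition cut_cycle7 := mask [:: false; true; false; true; true; true; true] cycle7.

Lemma cycle7_loopless : all (fun p => p.1 != p.2) (cycle7 ++ cut_cycle7).
Proof. by []. Qed.

Theorem corollary31 :
  (exists (VP : finType) (P : temporal_graph VP),
     [/\ temporal_path P, monotonically_shrinking P, consists_of_layers P 2
       & ~ exists p1 p2, nash_equilibrium P p1 p2]) /\
  (exists (VC : finType) (C : temporal_graph VC),
     [/\ temporal_cycle C, monotonically_shrinking C, consists_of_layers C 2
       & ~ exists p1 p2, nash_equilibrium C p1 p2]).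
Proof.
split; exists 'I_7.
  have sub_e : {subset drop 2 path7 <= path7} by move=> p /mem_drop.
  exists (two_layer_graph path7_loopless); split.
  - exists vertices7; split=> //; first exact: mem_vertices7.
    exact: two_layer_graph_underlying sub_e.
  - exact: two_layer_graph_shrinking.
  - exact: two_layer_graph_layers.
  (* At least two vertices are reached by time 1, and each later step adds a vertex or is stationary
     for good. With 7 vertices this happens by time $6=N+1$. *)
  - by apply: (no_nash_equilibrium uniq_vertices7 mem_vertices7 (N := 5));
      vm_compute.
have sub_e : {subset cut_cycle7 <= cycle7} by move=> p /mem_mask.
exists (two_layer_graph cycle7_loopless); split.
- exists vertices7; split=> //; first exact: mem_vertices7.
  exact: two_layer_graph_underlying sub_e.
- exact: two_layer_graph_shrinking.
- exact: two_layer_graph_layers.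
- by apply: (no_nash_equilibrium uniq_vertices7 mem_vertices7 (N := 5));
    vm_compute.
Qed.
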